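(* The spectrum of the variety $\mathbf{ARAGB}$ of anti-rectangular Abel Grassmann bands is $\{4^n : n \in \mathbb{N}\cup\{0\}\}$; that is, for a positive integer $m$ there is an anti-rectangular Abel Grassmann band with exactly $m$ elements if and only if $m = 4^n$ for some integer $n \ge 0$.
   Context: A groupoid is a nonempty set with a binary operation, written as juxtaposition. $\mathbf{ARAGB}$ is the variety of groupoids satisfying the equations $(xy)z=(zy)x$, $x = xx$ and $(xy)x=y$ for all elements $x,y,z$; its members are called anti-rectangular Abel Grassmann bands (anti-rectangular $AG$-bands). The spectrum of a groupoid variety $V$ is the set of orders (cardinalities) of the finite groupoids in $V$. Here $\mathbb{N}=\{1,2,3,\dots\}$. *)

(* Defs.v *)
From mathcomp Require Import all_boot.

Set Implicit Arguments.
Unset Strict Implicit.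
Unset Printing Implicit Defensive.

Definition has_order (T : Type) (m : nat) : Prop :=
  exists f : 'I_m -> T, bijective f.

(* A groupoid is a nonempty magma; [magmaType] admits the empty magma, hence
   the [inhabited] conjunct. *)
Definition ARAGB (G : magmaType) : Prop :=
  [/\ inhabited G,
      forall x y z : G, ((x * y) * z = (z * y) * x)%g,
      forall x : G, (x = x * x)%g
    & forall x y : G, ((x * y) * x = y)%g].

Definition spectrum (V : magmaType -> Prop) (m : nat) : Prop :=
  exists G : magmaType, V G /\ has_order G m.

(* Main.v *)
Require Import Defs.
From mathcomp Require Import all_boot.
From HB Require Import structures.
From mathcomp Require Import all_fingroup cyclic pgroup abelian sylow.

Set Implicit Arguments.
Unset Strict Implicit.
Unset Printing Implicit Defensive.

(** The anti-rectangular AG-bands are the affine spaces over the field F_4 of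
    four elements: if w is a generator of the multiplicative group of F_4, the
    product is x y = w x + w^2 y.

    Such products have all the powers of 4 as orders, since the space F_4^n
    satisfies the three equations coordinatewise.

    Conversely, choose a point o as origin of an ARAGB G.  The multiplication
    by w is x |-> x o, its inverse, the multiplication by w^2, is x |-> o x, and
    the sum x + y = w (w^2 x) + w^2 (w y) is (o x)(y o).  The axioms make this
    sum an abelian group law of exponent 2 with zero o, so that a finite G has
    order 2^k ([card_exponent2]).  They also make x |-> x o a permutation of
    order dividing 3 with o as its only fixed point, so that the order of G is
    1 modulo 3 ([card_order3_unique_fixpoint]).  As 2 = -1 modulo 3, the
    exponent k is even, and the order is a power of 4. *)

(** * Two counting principles *)

(** Every element has order dividing 2, so that Cauchy's theorem makes the
    group a 2-group. *)
Lemma card_exponent2 (T : finType) (add : T -> T -> T) (o : T) :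
    associative add -> left_id o add -> (forall x, add x x = o) ->
  exists k, #|T| = 2 ^ k.
Proof.
move=> addA add0 addxx.
have addNx : left_inverse o id add by [].
have addx0 : right_id o add by move=> x; rewrite -(addxx x) addA addxx add0.
pose gT : finGroupType :=
  HB.pack (Finite.sort T)
    (isGroup.Build T addA add0 addx0 addNx addNx).
have /p_natP[k cardk] : 2.-nat #|[set: gT]|.
  rewrite -[_.-nat _]/(2.-group [set: gT])%g -pnat_exponent.
  apply: (@pnat_dvd _ 2) => //.
  by apply/exponentP=> x _; exact: addxx.
exists k; rewrite -cardk cardsT.
(* The two finite structures on the carrier of T are not convertible, because
   the one of gT is rebuilt from the components of an abstract record. *)
by apply: (@bij_eq_card T gT id); exists id.
Qed.

(** The orbits of s other than {o} have exactly three elements. *)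
Lemma card_order3_unique_fixpoint (T : finType) (s : T -> T) (o : T) :
    (forall x, s (s (s x)) = x) -> (forall x, (s x == x) = (x == o)) ->
  #|T| = 1 %[mod 3].
Proof.
move=> s3 fixs.
have s_inj : injective s by apply: (can_inj (g := s \o s)) => x /=.
pose p := perm s_inj.
have p3 : (p ^+ 3 = 1)%g.
  by apply/permP=> x; rewrite !expgS expg0 mulg1 !permM !permE.
have p3group : (3.-group <[p]>)%g.
  by rewrite /pgroup -orderE; apply: (@pnat_dvd _ 3) => //; rewrite order_dvdn p3.
have acts : [acts <[p]>%g, on [set: T] | 'P]%g.
  by apply/actsP=> a _ x; rewrite !inE.
rewrite -cardsT (pgroup_fix_mod p3group acts) setTI -(cards1 o).
congr (#|pred_of_set _| %% _); apply/setP=> x.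
by rewrite afix_cycle ?inE // sub1set inE /= apermE permE fixs.
Qed.

(** Write k = 2 (k %/ 2) + r with r < 2: as 4 = 1 modulo 3, the power 2 ^ k is
    2 ^ r modulo 3, and r = 1 would give 2. *)
Lemma power2_1mod3 k : 2 ^ k = 1 %[mod 3] -> exists n, 2 ^ k = 4 ^ n.
Proof.
rewrite -{1 2}(odd_double_half k) -muln2 mulnC expnD expnM => e.
exists k./2; rewrite -[4]/(2 ^ 2) -expnM.
have pow4 : (2 ^ 2) ^ k./2 = 1 %[mod 3] by rewrite -modnXm exp1n.
by move/eqP: e; rewrite -modnMmr pow4; case: (odd k) => // _; rewrite mul1n.
Qed.

(** * From a band to a vector space over F_4 *)

Section Band.

Variable G : magmaType.
Hypothesis GP : ARAGB G.

Local Notation "x * y" := (mul x y).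

Let mulAG (x y z : G) : (x * y) * z = (z * y) * x.
Proof. by case: GP. Qed.

Let mulxx (x : G) : x * x = x.
Proof. by case: GP. Qed.

Let mulAR (x y : G) : (x * y) * x = y.
Proof. by case: GP. Qed.

(** In the affine form w x + w^2 y, both sides are
    w^2 x + y + z + w t. *)
Lemma band_medial (x y z t : G) : (x * y) * (z * t) = (x * z) * (y * t).
Proof. by rewrite mulAG (mulAG z) mulAG. Qed.

Lemma band_mulAR' (x y : G) : x * (y * x) = y.
Proof. by rewrite -{1}(mulxx x) band_medial mulxx mulAR. Qed.

Variable o : G.

(** In the F_4-structure with zero o, the factors are the scalar multiples
    w^2 x and w y. *)
Definition band_add (x y : G) := (o * x) * (y * o).

Lemma band_addC : commutative band_add.
Proof. by move=> x y; rewrite /band_add band_medial. Qed.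

Lemma band_add0 : left_id o band_add.
Proof. by move=> x; rewrite /band_add mulxx band_mulAR'. Qed.

Lemma band_addxx (x : G) : band_add x x = o.
Proof. by rewrite /band_add mulAG mulAR mulxx. Qed.

Lemma band_addA : associative band_add.
Proof.
(* Multiplication by w^2 distributes over the sum, hence
   (x + y) + z = ((x o) y)(z o), where the left invertive law exchanges x and z.
   Together with commutativity, this symmetry is associativity. *)
have expand x y z : band_add (band_add x y) z = ((x * o) * y) * (z * o).
  rewrite /band_add; congr (_ * _).
  rewrite -[X in X * _](mulxx o) band_medial band_mulAR'; congr (_ * _).
  by rewrite -{2}(mulAR o x) mulAG mulxx.
have swap x y z : band_add (band_add x y) z = band_add (band_add z y) x.
  by rewrite !expand mulAG.
by move=> x y z; rewrite band_addC (band_addC y) swap.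
Qed.

(** The square of x |-> x o is x |-> o x, by the left invertive law: this is
    w w = w^2. *)
Lemma band_rot3 (x : G) : ((x * o) * o) * o = x.
Proof. by rewrite (mulAG x) mulxx mulAR. Qed.

Lemma band_rot_fix (x : G) : x * o = x -> x = o.
Proof. by move=> xo; rewrite -[RHS](mulAR x) xo mulxx. Qed.

End Band.

(** The two counting principles apply to the sum and to x |-> x o, once a
    bijection with 'I_m has made G a finType. *)
Lemma ARAGB_order (G : magmaType) (m : nat) :
  ARAGB G -> has_order G m -> exists n, m = 4 ^ n.
Proof.
move=> GP [f f_bij]; have [[o] _ mulxx _] := GP.
have [g fK gK] := f_bij.
pose T : finType :=
  HB.pack (Magma.sort G) (Finite.copy (Magma.sort G) (can_type gK)).
have cardT : #|T| = m.
  by rewrite -(bij_eq_card (f_bij : bijective (f : _ -> T))) card_ord.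
have [k cardk] := @card_exponent2 T _ o (band_addA GP o) (band_add0 GP o)
  (band_addxx GP o).
have T1 : #|T| = 1 %[mod 3].
  apply: (@card_order3_unique_fixpoint T (fun x => x * o)%g o).
    exact: band_rot3.
  by move=> x; apply/eqP/eqP => [/(band_rot_fix GP)|->].
by rewrite -cardT cardk; apply: power2_1mod3; rewrite -cardk.
Qed.

(** * The space F_4^n as a band *)

(** The pair (a, b) stands for the element a + b w of F_4, where w^2 = w + 1. *)
Definition F4 := (bool * bool)%type.

(** In these coordinates, w (a + b w) = b + (a + b) w and
    w^2 (c + d w) = (c + d) + c w. *)
Definition F4_mul (x y : F4) : F4 :=
  (x.2 (+) (y.1 (+) y.2), (x.1 (+) x.2) (+) y.1).

Definition F4space (n : nat) := {ffun 'I_n -> F4}.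

Definition F4space_mul n (x y : F4space n) : F4space n :=
  [ffun i => F4_mul (x i) (y i)].

HB.instance Definition _ n := hasMul.Build (F4space n) (@F4space_mul n).

Lemma F4space_ARAGB n : ARAGB (F4space n).
Proof.
split; first by constructor; exact: [ffun=> (false, false)].
- move=> x y z; apply/ffunP=> i; rewrite !ffunE.
  by case: (x i) (y i) (z i) => [[] []] [[] []] [[] []].
- by move=> x; apply/ffunP=> i; rewrite !ffunE; case: (x i) => [[] []].
- move=> x y; apply/ffunP=> i; rewrite !ffunE.
  by case: (x i) (y i) => [[] []] [[] []].
Qed.

Lemma F4space_order n : has_order (F4space n) (4 ^ n).
Proof.
have <- : #|{: {ffun 'I_n -> F4}}| = 4 ^ n.
  by rewrite card_ffun card_prod card_bool card_ord.
by exists enum_val; exact: enum_val_bij.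
Qed.

Theorem corollary2 :
  forall m : nat, spectrum ARAGB m <-> exists n : nat, m = 4 ^ n.
Proof.
move=> m; split=> [[G [GP Gm]]|[n ->]]; first exact: ARAGB_order GP Gm.
by exists (F4space n); split; [exact: F4space_ARAGB | exact: F4space_order].
Qed.
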